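(* Let $A:H\to H$ be a positive trace class operator on a separable Hilbert space $H$. Let $H=H_1\oplus H_2$ be any orthogonal split, and fix any ordered orthonormal basis of $H_2$. Let $H_2^n$ denote the span of the first $n$ basis elements, let $P^n:=P_{H_1}+P_{H_2^n}$ denote the orthogonal projection of $H$ onto $H_1\oplus H_2^n$, and let $A^n:=P^nAP^n$ for $n=1,2,\ldots$. Then $$\mathcal{H}_1(A^n)\to\mathcal{H}_1(A)\quad\text{in trace norm as } n\to\infty.$$
   Context: A bounded symmetric operator $A$ on $H$ is positive if $\langle Ax,x\rangle\ge 0$ for all $x\in H$; $L_+(H)$ denotes the set of positive operators, and $X\leqq A$ means that $A-X$ is positive. $R(X)$ is the range of $X$. Shorted operator: for a closed subspace $S\subset H$ and $A\in L_+(H)$, the set $\{X\in L_+(H): X\leqq A,\ R(X)\subset S\}$ has a maximal (greatest) element with respect to $\leqq$, called the short of $A$ to $S$ and denoted $\mathcal{S}(A)$. For $S=H_1$ (so $S^\perp=H_2$) it is denoted $\mathcal{H}_1(A)$. The trace norm of a bounded operator $A$ is $\|A\|_1=\sum_i\langle|A|e_i,e_i\rangle$ for an orthonormal basis $(e_i)$ of $H$, where $|A|=\sqrt{A^*A}$; $A$ is trace class if this is finite. For a closed subspace $K\subset H$, $P_K$ is the orthogonal projection of $H$ onto $K$. If $H_2$ is finite dimensional, $H_2^n=H_2$ for $n\ge\dim H_2$. *)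

(* Defs.v *)
From HB Require Import structures.
From mathcomp Require Import all_boot all_order all_algebra.
From mathcomp Require Import complex.
From mathcomp Require Import all_classical all_reals.
From mathcomp Require Import topology ereal normedtype sequences.

Set Implicit Arguments.
Unset Strict Implicit.
Unset Printing Implicit Defensive.

Import Order.TTheory GRing.Theory Num.Theory.
Import numFieldNormedType.Exports.

Local Open Scope classical_set_scope.
Local Open Scope ring_scope.

(* Hilbert spaces are taken over either the real or the complex numbers. *)
Variant scalar_kind := RealScalars | ComplexScalars.

Definition base_field (R : realType) (k : scalar_kind) : numFieldType :=
  match k with RealScalars => R | ComplexScalars => R[i] end.

Definition sconj (R : realType) (k : scalar_kind) :
    base_field R k -> base_field R k :=
  match k return base_field R k -> base_field R k with
  | RealScalars => idfun
  | ComplexScalars => @conjc R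
  end.

Definition sre (R : realType) (k : scalar_kind) : base_field R k -> R :=
  match k return base_field R k -> R with
  | RealScalars => idfun
  | ComplexScalars => @complex.Re R
  end.

(* The inner product is linear in its first argument and conjugate-linear in
   the second one. *)
Record hilbertSpace (R : realType) (k : scalar_kind) := HilbertSpace {
  hilbert_carrier :> completeNormedModType (base_field R k) ;
  inner : {dot hilbert_carrier for @sconj R k} ;
  inner_normE : forall x : hilbert_carrier, `|x| ^+ 2 = inner x x }.

Definition separable_space (T : topologicalType) : Prop :=
  exists2 D : set T, countable D & dense D.

Section Hilbert.
Context {R : realType} {k : scalar_kind} {H : hilbertSpace R k}.
Local Notation K := (base_field R k).
Local Notation "''[' x , y ]" := (inner H x y) : ring_scope.
Implicit Types (S : set H) (A B X Y : H -> H).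

Definition linear_subspace S : Prop := submod_closed [in S].

Definition closed_subspace S : Prop := linear_subspace S /\ closed S.

Definition linear_span (G : set H) : set H := smallest linear_subspace G.

Definition orthogonal_direct_sum (H1 H2 : set H) : Prop :=
  [/\ closed_subspace H1, closed_subspace H2,
      forall x y, H1 x -> H2 y -> '[x, y] = 0 &
      forall z, exists x y, [/\ H1 x, H2 y & z = x + y]].

(* An ordered orthonormal basis of S is the family e restricted to I, where I
   is either nat or {0, ..., d - 1}; the values of e outside I are junk. *)
Definition orthonormal_basis S (I : set nat) (e : nat -> H) : Prop :=
  [/\ forall i j, (i <= j)%N -> I j -> I i,
      forall i j, I i -> I j -> '[e i, e j] = (i == j)%:R &
      closure (linear_span (e @` I)) = S].

(* span of the basis elements among e 0, ..., e (n - 1); it is the span of the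
   whole basis when n is at least the dimension *)
Definition first_span (I : set nat) (e : nat -> H) (n : nat) : set H :=
  linear_span (e @` (I `&` `I_n)).

Definition bounded_operator A : Prop :=
  linear A /\ exists M : K, forall x, `|A x| <= M * `|x|.

Definition symmetric_operator A : Prop := forall x y, '[A x, y] = '[x, A y].

(* Over the complex scalars, 0 <= z also says that z is real. *)
Definition positive_operator A : Prop :=
  [/\ bounded_operator A, symmetric_operator A & forall x, 0 <= '[A x, x]].

Definition ople X Y : Prop := positive_operator (Y \- X).

Definition orthoproj S (x : H) : H :=
  xget 0 [set y | S y /\ forall z, S z -> '[x - y, z] = 0].

Definition short_candidates S A : set (H -> H) :=
  [set X | [/\ positive_operator X, ople X A & range X `<=` S]].

Definition short S A : H -> H :=
  xget (cst 0)
    [set X | short_candidates S A X /\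
             forall Y, short_candidates S A Y -> ople Y X].

Definition adjoint_operator A : H -> H :=
  xget (cst 0)
    [set B | bounded_operator B /\ forall x y, '[A x, y] = '[x, B y]].

Definition abs_operator A : H -> H :=
  xget (cst 0) [set B | positive_operator B /\ B \o B = adjoint_operator A \o A].

(* Trace norm computed in the orthonormal basis (I, e) of H; all terms are
   nonnegative, and the sum does not depend on the basis. *)
Definition trace_norm (I : set nat) (e : nat -> H) A : \bar R :=
  (\sum_(i <oo | i \in I) (sre '[abs_operator A (e i), e i])%:E)%E.

Definition trace_class A : Prop :=
  bounded_operator A /\
  exists I e, orthonormal_basis setT I e /\ (trace_norm I e A < +oo)%E.

Definition split_proj (H1 : set H) (I : set nat) (e : nat -> H) (n : nat) :
    H -> H :=
  orthoproj H1 \+ orthoproj (first_span I e n).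

Definition compression (H1 : set H) (I : set nat) (e : nat -> H) A (n : nat) :
    H -> H :=
  split_proj H1 I e n \o A \o split_proj H1 I e n.

End Hilbert.

(* Main.v *)
Require Import Defs.
From HB Require Import structures.
From mathcomp Require Import all_boot all_order all_algebra.
From mathcomp Require Import complex.
From mathcomp Require Import all_classical all_reals.
From mathcomp Require Import ring lra.
From mathcomp Require Import topology ereal normedtype sequences.

(** The idea is to compute shorts by Gaussian elimination.  For a positive
    operator [A] and a vector [e], the Schur complement
    [A - (A e)(A e)^* / <A e, e>] is positive, lies below [A], and kills [e].
    Eliminating the basis vectors [e 0], [e 1], ... of [H2] one after the other
    gives a decreasing sequence [A_n] of positive operators, which converges
    strongly to a positive operator [L] ([schur_elim_limit]).  The limit kills
    [H2], and every [X] below [A] with range in [H1] lies below each [A_n]; so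
    [L] is the short of [A] ([short_elim_limit]).  For the compression
    [P^n A P^n], the first [n] elimination steps commute with the compression,
    and nothing of [H2] is left after them; its short is [P_1 A_n P_1], where
    [P_1] projects onto [H1] ([short_compression]).

    Hence the difference of the two shorts is [D_n = P_1 (A_n - L) P_1], a
    positive operator tending strongly to 0.  A positive operator is its own
    absolute value, by uniqueness of the positive square root
    ([square_monotone]), so the trace norm of [D_n] is the sum of its
    diagonal terms in the basis [f].  Each term tends to 0 and is at most
    [<A P_1 (f i), P_1 (f i)>].  These bounds have a finite sum: [A] has finite
    trace in some orthonormal basis, and by [trace_bessel_le] that trace bounds
    the sum over any family satisfying Bessel's inequality, such as the
    projected basis [P_1 (f i)].  Dominated convergence for series then
    concludes.

    The same elimination, applied along a basis of the whole space, also yields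
    Bessel's inequality and Parseval's identity (starting from the identity
    operator) and the trace comparison (starting from [A]). *)

Set Implicit Arguments.
Unset Strict Implicit.
Unset Printing Implicit Defensive.

Import Order.TTheory GRing.Theory Num.Theory.
Import numFieldNormedType.Exports.
Local Open Scope classical_set_scope.
Local Open Scope ring_scope.

Local Notation "''[' x , y ]" := (inner _ x y) : ring_scope.

(** * Real and complex scalars *)

Section Scalars.
Context {R : realType} {k : scalar_kind}.
Local Notation K := (base_field R k).
Implicit Types z w : K.

Lemma mul_sconj z : z * sconj z = `|z| ^+ 2.
Proof.
case: k z => /= z; first by rewrite -normrX ger0_norm ?sqr_ge0.
by rewrite sqr_normc.
Qed.

Lemma norm_sconj z : `|sconj z| = `|z|.
Proof. by case: k z => //= z; rewrite normcJ. Qed.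

Lemma sconj_real z : z \is Num.real -> sconj z = z.
Proof. by case: k z => //= z /complex_realP[r ->]; rewrite conjc_real. Qed.

Lemma sconj_idP z : sconj z = z -> z \is Num.real.
Proof.
case: k z => /= z; first by rewrite num_real.
case: z => a b [] /eqP; rewrite eq_sym -subr_eq0 opprK -mulr2n mulrn_eq0 /=.
by rewrite complex_real.
Qed.

Lemma sconjM z w : sconj (z * w) = sconj z * sconj w.
Proof. by case: k z w => //= z w; rewrite rmorphM. Qed.

Lemma sre_zmod_morphism : zmod_morphism (@sre R k).
Proof. by case: k => // x y; rewrite /sre /= raddfB. Qed.

HB.instance Definition _ :=
  GRing.isZmodMorphism.Build K R (@sre R k) sre_zmod_morphism.

Definition scast (r : R) : K :=
  match k return base_field R k with
  | RealScalars => r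
  | ComplexScalars => real_complex R r
  end.

Lemma scastK : cancel scast (@sre R k).
Proof. by rewrite /scast /sre; case: k. Qed.

Lemma sreK z : z \is Num.real -> scast (sre z) = z.
Proof. by rewrite /scast /sre; case: k z => //= z; exact: RRe_real. Qed.

Lemma scastM r s : scast (r * s) = scast r * scast s.
Proof. by rewrite /scast; case: k => //; rewrite rmorphM. Qed.

Lemma scast_real r : scast r \is Num.real.
Proof.
by rewrite /scast; case: k; rewrite ?num_real //; apply/complex_realP; exists r.
Qed.

Lemma ler_scast r s : (scast r <= scast s) = (r <= s).
Proof. by rewrite /scast; case: k => //; rewrite lecR. Qed.

Lemma ltr_scast r s : (scast r < scast s) = (r < s).
Proof. by rewrite /scast; case: k => //; rewrite ltcR. Qed.

Lemma scast0 : scast 0 = 0.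
Proof. by rewrite /scast; case: k. Qed.

Lemma scast_ge0 r : (0 <= scast r) = (0 <= r).
Proof. by rewrite -{1}scast0 ler_scast. Qed.

Lemma sre_ge0 z : 0 <= z -> 0 <= sre z.
Proof. by move=> z0; rewrite -scast_ge0 sreK// ger0_real. Qed.

Lemma ler_sre z w : z <= w -> sre z <= sre w.
Proof. by rewrite -subr_ge0 => /sre_ge0; rewrite raddfB subr_ge0. Qed.

Lemma sre_real_ge0 z : z \is Num.real -> (0 <= z) = (0 <= sre z).
Proof. by move=> /sreK zE; rewrite -{1}zE scast_ge0. Qed.

Lemma sreMl z w : z \is Num.real -> sre (z * w) = sre z * sre w.
Proof.
case: k z w => //= z w /complex_realP[r ->].
by case: w => a b /=; rewrite mul0r subr0.
Qed.

Lemma norm_sre_le z : `|sre z| <= sre `|z|.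
Proof.
rewrite -ler_scast sreK ?ger0_real//.
by rewrite /scast; case: k z => //= z; exact: normc_ge_Re.
Qed.

Lemma cvg_sre (T : Type) (F : set_system T) (FF : Filter F)
    (u : T -> K) (l : K) :
  u x @[x --> F] --> l -> sre (u x) @[x --> F] --> sre l.
Proof.
move=> ul; apply/cvgrPdist_lt => eps eps0.
have eps0' : 0 < scast eps by rewrite -scast0 ltr_scast.
move/cvgrPdist_lt: ul => /(_ _ eps0'); apply: filterS => x /=.
move=> h; rewrite -raddfB; apply: le_lt_trans (norm_sre_le _) _.
by rewrite -ltr_scast sreK// ger0_real.
Qed.
End Scalars.

(** * Inner products and positive forms *)

Section InnerProduct.
Context {R : realType} {k : scalar_kind} {H : hilbertSpace R k}.
Local Notation K := (base_field R k).
Implicit Types (x y z : H) (a : K).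

Lemma dotC x y : '[x, y] = sconj '[y, x].
Proof. by rewrite (@hermitian_subproof _ _ _ _ (inner H)) expr0 mul1r. Qed.

Lemma dotDl x y z : '[x + y, z] = '[x, z] + '[y, z].
Proof. by rewrite linearDl. Qed.

Lemma dotDr x y z : '[x, y + z] = '[x, y] + '[x, z].
Proof. by rewrite linearDr. Qed.

Lemma dotBl x y z : '[x - y, z] = '[x, z] - '[y, z].
Proof. by rewrite linearBl. Qed.

Lemma dotBr x y z : '[x, y - z] = '[x, y] - '[x, z].
Proof. by rewrite linearBr. Qed.

Lemma dotZl a x y : '[a *: x, y] = a * '[x, y].
Proof. by rewrite linearZl_LR. Qed.

Lemma dotZr a x y : '[x, a *: y] = sconj a * '[x, y].
Proof. by rewrite linearZr_LR. Qed.

Lemma dot0l x : '[0, x] = 0.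
Proof. by rewrite linear0l. Qed.

Lemma dot0r x : '[x, 0] = 0.
Proof. by rewrite linear0r. Qed.

Lemma dot_suml (T : Type) (r : seq T) (P : pred T) (F : T -> H) y :
  '[\sum_(i <- r | P i) F i, y] = \sum_(i <- r | P i) '[F i, y].
Proof. by rewrite linear_sumlz. Qed.

Lemma norm_dotC x y : `|'[x, y]| = `|'[y, x]|.
Proof. by rewrite dotC norm_sconj. Qed.

Lemma dot_ge0 x : 0 <= '[x, x].
Proof. by rewrite -inner_normE exprn_ge0. Qed.

Lemma dot_eq0 x : '[x, x] = 0 -> x = 0.
Proof. by rewrite -inner_normE => /eqP; rewrite expf_eq0/= normr_eq0 => /eqP. Qed.

Lemma dot_ext x y : (forall z, '[z, x] = '[z, y]) -> x = y.
Proof.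
by move=> xy; apply/subr0_eq/dot_eq0; rewrite dotBr xy subrr.
Qed.

Section LinearMaps.
Context (A : H -> H) (linA : linear A).

Lemma lin0 : A 0 = 0.
Proof. by have := linA (-1) 0 0; rewrite scaler0 addr0 scaleN1r addNr. Qed.

Lemma linD x y : A (x + y) = A x + A y.
Proof. by rewrite -{1}[x]scale1r linA scale1r. Qed.

Lemma linZ a x : A (a *: x) = a *: A x.
Proof. by rewrite -[a *: x]addr0 linA lin0 addr0. Qed.

Lemma linB x y : A (x - y) = A x - A y.
Proof. by rewrite linD -scaleN1r linZ scaleN1r. Qed.

Lemma lin_sum (T : Type) (r : seq T) (P : pred T) (F : T -> H) :
  A (\sum_(i <- r | P i) F i) = \sum_(i <- r | P i) A (F i).
Proof. by apply: (big_morph A linD lin0). Qed.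
End LinearMaps.

Section CauchySchwarz.
Context (A : H -> H) (linA : linear A) (symA : symmetric_operator A)
  (posA : forall x, 0 <= '[A x, x]).

Let form_shift s x y : s \is Num.real ->
  '[A (x - (s * '[A x, y]) *: y), x - (s * '[A x, y]) *: y] =
  '[A x, x] - (s * `|'[A x, y]| ^+ 2) *+ 2
    + s ^+ 2 * `|'[A x, y]| ^+ 2 * '[A y, y].
Proof.
move=> /sconj_real rs; set b := '[A x, y].
rewrite linB// linZ// !(dotBl, dotBr, dotZl, dotZr) sconjM rs.
have -> : '[A y, x] = sconj b by rewrite symA dotC.
rewrite -/b.
have -> : s * sconj b * b = s * `|b| ^+ 2.
  by rewrite -mul_sconj -mulrA [sconj b * b]mulrC.
have -> : s * b * sconj b = s * `|b| ^+ 2 by rewrite -mul_sconj -mulrA.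
have -> : s * b * (s * sconj b * '[A y, y]) = s ^+ 2 * `|b| ^+ 2 * '[A y, y].
  by rewrite -mul_sconj; ring.
by ring.
Qed.

(** Cauchy-Schwarz for the semidefinite form of [A].  The form is evaluated at
    [x - (s * '[A x, y]) *: y] for a real [s]; the degenerate case
    [ '[A y, y] = 0 ] is included because the quadratic in [s] is then affine
    and cannot stay nonnegative unless ['[A x, y]] vanishes. *)
Lemma form_cauchy_schwarz x y :
  `|'[A x, y]| ^+ 2 <= '[A x, x] * '[A y, y].
Proof.
set b := '[A x, y]; set p := '[A x, x]; set c := '[A y, y].
have p0 : 0 <= p by exact: posA.
have c0 : 0 <= c by exact: posA.
have b0 : 0 <= `|b| ^+ 2 by rewrite exprn_ge0.
have [cz|cnz] := eqVneq c 0.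
  have [->|bnz] := eqVneq (`|b| ^+ 2) 0; first by rewrite mulr_ge0.
  (* the form at this [s] equals p - 2 (p + 1) < 0 *)
  pose s := (p + 1) / (`|b| ^+ 2).
  have rs : s \is Num.real by rewrite ger0_real// divr_ge0// addr_ge0.
  have := posA (x - (s * b) *: y).
  rewrite form_shift// -/b -/p -/c cz mulr0 addr0 /s divfK// => h.
  exfalso; move: h; apply/negP; rewrite lt_geF// subr_lt0 mulr2n.
  by rewrite -addrA ltrDl ltr_pwDl ?addr_ge0.
have rs : c^-1 \is Num.real by rewrite ger0_real// invr_ge0.
have := posA (x - (c^-1 * b) *: y).
rewrite form_shift// -/b -/p -/c.
have -> : p - (c^-1 * `|b| ^+ 2) *+ 2 + c^-1 ^+ 2 * `|b| ^+ 2 * c =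
  p - `|b| ^+ 2 / c.
  have -> : c^-1 ^+ 2 * `|b| ^+ 2 * c = c^-1 * `|b| ^+ 2.
    by rewrite mulrAC expr2 mulfVK.
  by rewrite mulr2n opprD addrA subrK mulrC.
by rewrite subr_ge0 ler_pdivrMr// lt_def cnz.
Qed.
End CauchySchwarz.

Lemma cauchy_schwarz x y : `|'[x, y]| <= `|x| * `|y|.
Proof.
rewrite -(ler_pXn2r (n := 2))// ?nnegrE ?mulr_ge0// exprMn !inner_normE.
by apply: (@form_cauchy_schwarz idfun) => // z; exact: dot_ge0.
Qed.
End InnerProduct.

(** * Positive operators and Schur elimination *)

Section PositiveOperators.
Context {R : realType} {k : scalar_kind} {H : hilbertSpace R k}.
Local Notation K := (base_field R k).
Implicit Types (x y z : H) (A B X Y : H -> H).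

Lemma bounded_operator_ge0 A : bounded_operator A ->
  exists2 M : K, 0 <= M & forall x, `|A x| <= M * `|x|.
Proof.
case=> _ [M AM]; exists `|M| => // x.
have Mx : 0 <= M * `|x| by apply: le_trans (AM x).
by rewrite -[`|x|]normr_id -normrM ger0_norm.
Qed.

(** A bound on the quadratic form controls the vector [A x] itself: apply
    Cauchy-Schwarz for the form of [A] to the pair [x], [A x].  This is what
    turns monotone convergence of forms into convergence of vectors, and
    vanishing of the form into vanishing of the operator. *)
Lemma form_bound_norm A (M : K) : linear A -> symmetric_operator A ->
    (forall x, 0 <= '[A x, x]) -> (forall x, '[A x, x] <= M * `|x| ^+ 2) ->
  forall x, `|A x| ^+ 2 <= M * '[A x, x].
Proof.
move=> linA symA posA AM x.
have [->|Ax0] := eqVneq (A x) 0.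
  by rewrite normr0 expr0n dot0l mulr0.
have Axp : 0 < `|A x| ^+ 2 by rewrite exprn_gt0// normr_gt0.
have := form_cauchy_schwarz linA symA posA x (A x).
rewrite -inner_normE => /le_trans /(_ (ler_wpM2l (posA x) (AM (A x)))).
rewrite (ger0_norm (ltW Axp)) [_ ^+ 2 ^+ 2]expr2 [X in _ <= X]mulrA ler_pM2r//.
by rewrite [X in _ <= X]mulrC.
Qed.

Lemma positive_of_form_bound A (M : K) : linear A -> symmetric_operator A ->
    0 <= M -> (forall x, 0 <= '[A x, x]) ->
    (forall x, '[A x, x] <= M * `|x| ^+ 2) ->
  positive_operator A.
Proof.
move=> linA symA M0 posA AM; split=> //; split=> //; exists M => x.
have [->|Ax0] := eqVneq (A x) 0; first by rewrite normr0 mulr_ge0.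
have Axp : 0 < `|A x| by rewrite normr_gt0.
rewrite -(ler_pM2l Axp) -expr2.
apply: le_trans (form_bound_norm linA symA posA AM x) _.
rewrite mulrCA ler_wpM2l// -[X in X <= _]ger0_norm//.
exact: cauchy_schwarz.
Qed.

Lemma positive_form_bound A : positive_operator A ->
  exists2 M : K, 0 <= M & forall x, '[A x, x] <= M * `|x| ^+ 2.
Proof.
case=> /bounded_operator_ge0[M M0 AM] _ posA; exists M => // x.
rewrite -[X in X <= _]ger0_norm//; apply: le_trans (cauchy_schwarz _ _) _.
by rewrite expr2 mulrA ler_wpM2r.
Qed.

Lemma positive_bounded A : positive_operator A -> bounded_operator A.
Proof. by case. Qed.

Lemma positive_linear A : positive_operator A -> linear A.
Proof. by case=> -[]. Qed.

Lemma positive_sym A : positive_operator A -> symmetric_operator A.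
Proof. by case. Qed.

Lemma positive_ge0 A x : positive_operator A -> 0 <= '[A x, x].
Proof. by case. Qed.

Lemma positive_form_le A B : positive_operator B -> linear A ->
    symmetric_operator A -> (forall x, 0 <= '[A x, x]) ->
    (forall x, '[A x, x] <= '[B x, x]) ->
  positive_operator A.
Proof.
move=> /positive_form_bound[M M0 BM] linA symA posA AB.
by apply: (positive_of_form_bound linA symA M0) => // x; apply: le_trans (BM x).
Qed.

Lemma linear_subop A B : linear A -> linear B -> linear (A \- B).
Proof.
move=> linA linB a x y /=; rewrite linA linB scalerBr opprD.
by rewrite addrACA.
Qed.

Lemma symmetric_subop A B :
  symmetric_operator A -> symmetric_operator B -> symmetric_operator (A \- B).
Proof. by move=> sA sB x y /=; rewrite dotBl dotBr sA sB. Qed.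

Lemma ople_form X Y : positive_operator X -> positive_operator Y ->
  (forall x, '[X x, x] <= '[Y x, x]) -> ople X Y.
Proof.
move=> posX posY XY; apply: (positive_form_le posY).
- exact: linear_subop (positive_linear posY) (positive_linear posX).
- exact: symmetric_subop (positive_sym posY) (positive_sym posX).
- by move=> x; rewrite /= dotBl subr_ge0.
- by move=> x; rewrite /= dotBl gerBl positive_ge0.
Qed.

Lemma ople_le X Y x : ople X Y -> '[X x, x] <= '[Y x, x].
Proof. by move=> /positive_ge0 - /(_ x) /=; rewrite dotBl subr_ge0. Qed.

Lemma positive_kernel A x : positive_operator A -> '[A x, x] = 0 -> A x = 0.
Proof.
move=> posA Ax0; have [M M0 AM] := positive_form_bound posA.
have := form_bound_norm (positive_linear posA) (positive_sym posA)
  (fun y => positive_ge0 y posA) AM x.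
rewrite Ax0 mulr0 => h; apply/normr0_eq0/eqP; rewrite -[_ == _](expf_eq0 _ 2).
by rewrite eq_le h exprn_ge0.
Qed.

Lemma positive_form_eq A B : positive_operator A -> positive_operator B ->
  (forall x, '[A x, x] = '[B x, x]) -> A = B.
Proof.
move=> posA posB AB.
have posD : ople B A by apply: ople_form => // x; rewrite AB.
apply/funext => x; apply/subr0_eq; apply: (positive_kernel posD).
by rewrite /= dotBl AB subrr.
Qed.

Lemma ople_anti A B : positive_operator A -> positive_operator B ->
  ople A B -> ople B A -> A = B.
Proof.
move=> posA posB AB BA; apply: positive_form_eq => // x.
by apply/eqP; rewrite eq_le !ople_le.
Qed.

(** One step of Gaussian elimination: subtract from [A] the rank one operator
    that makes [e] isotropic.  When ['[A e, e] = 0], positivity already forces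
    [A e = 0], in accordance with the convention that the inverse of 0 is 0. *)
Definition schur_step A (e : H) : H -> H :=
  fun x => A x - ('[A x, e] / '[A e, e]) *: A e.

Section SchurStep.
Context (A : H -> H) (posA : positive_operator A) (e : H).

Lemma schur_step_linear : linear (schur_step A e).
Proof.
have linA := positive_linear posA.
move=> a x y; rewrite /schur_step linA dotDl dotZl mulrDl scalerDl -mulrA.
by rewrite -[(a * _) *: A e]scalerA scalerBr opprD addrACA.
Qed.

Lemma schur_step_sym : symmetric_operator (schur_step A e).
Proof.
have symA := positive_sym posA.
move=> x y; rewrite /schur_step dotBl dotBr dotZl dotZr sconjM -dotC.
have -> : sconj '[A e, e]^-1 = '[A e, e]^-1.
  by apply: sconj_real; rewrite ger0_real// invr_ge0 positive_ge0.
rewrite !symA; congr (_ - _).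
by rewrite mulrAC [_ * '[e, A y]]mulrC mulrAC.
Qed.

Lemma schur_step_form x :
  '[schur_step A e x, x] = '[A x, x] - `|'[A x, e]| ^+ 2 / '[A e, e].
Proof.
rewrite /schur_step dotBl dotZl mulrAC.
have -> : '[A e, x] = sconj '[A x, e] by rewrite (positive_sym posA) dotC.
by rewrite mul_sconj.
Qed.

Lemma schur_step_form_le x : '[schur_step A e x, x] <= '[A x, x].
Proof.
by rewrite schur_step_form gerBl divr_ge0 ?exprn_ge0 ?positive_ge0.
Qed.

(** Positivity of the Schur complement is exactly the Cauchy-Schwarz inequality
    between [x] and [e] for the form of [A]. *)
Lemma schur_step_form_ge0 x : 0 <= '[schur_step A e x, x].
Proof.
rewrite schur_step_form subr_ge0.
have [->|Ae0] := eqVneq '[A e, e] 0; first by rewrite invr0 mulr0 positive_ge0.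
rewrite ler_pdivrMr ?lt_def ?Ae0 ?positive_ge0//.
apply: form_cauchy_schwarz; [exact: positive_linear|exact: positive_sym|].
by move=> y; exact: positive_ge0.
Qed.

Lemma schur_step_positive : positive_operator (schur_step A e).
Proof.
apply: (positive_form_le posA); [exact: schur_step_linear|
  exact: schur_step_sym|exact: schur_step_form_ge0|exact: schur_step_form_le].
Qed.

Lemma schur_step_pivot : schur_step A e e = 0.
Proof.
rewrite /schur_step; have [Ae0|Ae0] := eqVneq '[A e, e] 0.
  by rewrite (positive_kernel posA Ae0) scaler0 subrr.
by rewrite divff// scale1r subrr.
Qed.

Lemma schur_step_kernel x : A x = 0 -> schur_step A e x = 0.
Proof. by rewrite /schur_step => ->; rewrite dot0l mul0r scale0r subrr. Qed.

Lemma schur_step_shift x :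
  schur_step A e x = A (x - ('[A x, e] / '[A e, e]) *: e).
Proof.
by rewrite (linB (positive_linear posA)) (linZ (positive_linear posA)).
Qed.
End SchurStep.

Fixpoint schur_elim A (e : nat -> H) n : H -> H :=
  if n is m.+1 then schur_step (schur_elim A e m) (e m) else A.

Section SchurElim.
Context (A : H -> H) (posA : positive_operator A) (e : nat -> H).
Local Notation A_ := (schur_elim A e).

Lemma schur_elim_positive n : positive_operator (A_ n).
Proof. by elim: n => // n IH; exact: schur_step_positive. Qed.

Lemma schur_elim_kills j n : (j < n)%N -> A_ n (e j) = 0.
Proof.
elim: n => // n IH; rewrite ltnS leq_eqVlt => /predU1P[->|jn] /=.
  exact: schur_step_pivot (schur_elim_positive n) _.
exact: schur_step_kernel (IH jn).
Qed.

Lemma schur_elim_form_le m n x : (m <= n)%N -> '[A_ n x, x] <= '[A_ m x, x].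
Proof.
move=> /subnK <-; elim: (n - m)%N => // d IH; rewrite addSn.
exact: le_trans (schur_step_form_le (schur_elim_positive _) _ _) IH.
Qed.

(** Elimination only moves the argument by a combination of the eliminated
    vectors; the displaced argument is where the minimum of the form of [A] over
    [x + span (e 0, ..., e n.-1)] is reached, which is how shorts are compared
    with eliminated operators. *)
Lemma schur_elim_shift n x : exists c : nat -> K,
  A_ n x = A (x - \sum_(0 <= j < n) c j *: e j).
Proof.
elim: n x => [|n IH] x.
  by exists (fun=> 0); rewrite big_geq// subr0.
rewrite /= (schur_step_shift (schur_elim_positive n)).
set t := (_ / _); have [c ->] := IH (x - t *: e n).
exists (fun j => if j == n then t else c j).
rewrite big_nat_recr//= eqxx opprD addrAC addrA; congr (A (_ - _ - _)).
by apply: eq_big_nat => j /andP[_ jn]; rewrite ltn_eqF.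
Qed.

(** The Cholesky decomposition of the form of [A] with remainder. *)
Lemma schur_elim_form n x : '[A x, x] =
  '[A_ n x, x] + \sum_(0 <= j < n) `|'[A_ j (e j), x]| ^+ 2 / '[A_ j (e j), e j].
Proof.
elim: n => [|n IH]; first by rewrite big_geq// addr0.
rewrite big_nat_recr//= IH (schur_step_form (schur_elim_positive n)).
have -> : `|'[A_ n x, e n]| = `|'[A_ n (e n), x]|.
  by rewrite norm_dotC (positive_sym (schur_elim_positive n)).
by rewrite addrACA addNr addr0.
Qed.
End SchurElim.
End PositiveOperators.

(** * Strong limits of decreasing sequences *)

Section StrongLimits.
Context {R : realType} {k : scalar_kind} {H : hilbertSpace R k}.
Local Notation K := (base_field R k).
Implicit Types (x y z : H) (A B X Y : H -> H).

Lemma cvg_dotl (u : nat -> H) (l y : H) :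
  u n @[n --> \oo] --> l -> '[u n, y] @[n --> \oo] --> '[l, y].
Proof.
move=> /cvgrPdist_lt ul; apply/cvgrPdist_lt => eps eps0.
have y1 : 0 < `|y| + 1 by rewrite ltr_wpDl.
have /ul := divr_gt0 eps0 y1; apply: filterS => n.
rewrite ltr_pdivlMr// => h; rewrite -dotBl.
apply: le_lt_trans (cauchy_schwarz _ _) (le_lt_trans _ h).
by rewrite ler_wpM2l// lerDl.
Qed.

Lemma cvg_dotr (u : nat -> H) (l y : H) :
  u n @[n --> \oo] --> l -> '[y, u n] @[n --> \oo] --> '[y, l].
Proof.
move=> ul; have /cvgrPdist_lt {}ul := cvg_dotl (y := y) ul; apply/cvgrPdist_lt => eps /ul.
by apply: filterS => n; rewrite -dotBr norm_dotC dotBl.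
Qed.

Lemma sre_dotC x y : sre '[x, y] = sre '[y, x].
Proof.
by rewrite dotC /sre; move: '[y, x]; rewrite /sconj; case: k => // -[a b].
Qed.

Lemma form_real A x : symmetric_operator A -> '[A x, x] \is Num.real.
Proof. by move=> symA; apply: sconj_idP; rewrite -dotC symA. Qed.

Section MonotoneLimit.
Context (B : nat -> H -> H) (posB : forall n, positive_operator (B n))
  (decB : forall m n x, (m <= n)%N -> '[B n x, x] <= '[B m x, x]).

Let a x n : R := sre '[B n x, x].

Let a_noninc x : nonincreasing_seq (a x).
Proof. by move=> m n mn; apply/ler_sre/decB. Qed.

Let a_cvg x : cvgn (a x).
Proof.
apply: nonincreasing_is_cvgn (a_noninc x) _.
by exists 0 => _ [n _ <-]; apply/sre_ge0/positive_ge0.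
Qed.

Let B_cauchy x : cvg (B n x @[n --> \oo]).
Proof.
apply/cauchy_cvgP/cauchy_exP => eps eps0.
have [M M0 BM] := positive_form_bound (posB 0%N).
have epsE : eps = scast (sre eps) by rewrite sreK// gtr0_real.
have e0 : 0 < sre eps by rewrite -(ltr_scast (k := k)) scast0 -epsE.
have M1 : 0 < sre M + 1 by rewrite ltr_wpDl ?sre_ge0.
have d0 : 0 < (sre eps) ^+ 2 / (sre M + 1) by rewrite divr_gt0 ?exprn_gt0.
have [N _ aN] : \forall n \near \oo, `|limn (a x) - a x n| < sre eps ^+ 2 / (sre M + 1).
  by have /cvgrPdist_lt := @a_cvg x; apply.
exists (B N x); exists N => // n /= Nn.
rewrite -ball_normE /=.
have posC : ople (B n) (B N) by apply: ople_form => // z; exact: decB.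
have /= := form_bound_norm (positive_linear posC) (positive_sym posC)
  (fun y => positive_ge0 y posC) _ x.
move=> /(_ M) h.
have {}h : `|B N x - B n x| ^+ 2 <= M * '[B N x - B n x, x].
  apply: h => y; apply: le_trans (BM y); rewrite dotBl.
  apply: le_trans (decB y (leq0n N)).
  by rewrite gerBl positive_ge0.
rewrite -(ltr_pXn2r (n := 2)) ?nnegrE// ?(ltW eps0)//.
apply: le_lt_trans h _; rewrite epsE expr2 -scastM -(sreK (ger0_real M0)).
rewrite -[X in _ * X]sreK; last exact: form_real (positive_sym posC).
rewrite -scastM ltr_scast.
have lea : sre '[B N x - B n x, x] < (sre eps) ^+ 2 / (sre M + 1).
  rewrite dotBl raddfB -/(a x N) -/(a x n).
  apply: le_lt_trans (aN N _); last exact: leqnn.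
  rewrite distrC; apply: le_trans (ler_norm _); rewrite lerD2l lerN2.
  exact: nonincreasing_cvgn_ge.
apply: (@le_lt_trans _ _ ((sre M + 1) * sre '[B N x - B n x, x])).
  by rewrite ler_wpM2r ?lerDl// sre_ge0// (positive_ge0 x posC).
by rewrite mulrC -ltr_pdivlMr// -expr2.
Qed.

(** The real numbers ['[B n x, x]] decrease, hence form a Cauchy sequence, and
    [form_bound_norm] applied to the positive operators [B m \- B n] transfers
    this to the vectors [B n x]; the bound is uniform since all these operators
    lie below [B 0]. *)
Lemma monotone_strong_limit : exists L : H -> H,
  [/\ positive_operator L, forall x, B n x @[n --> \oo] --> L x &
      forall n x, '[L x, x] <= '[B n x, x]].
Proof.
pose L x := lim (B n x @[n --> \oo]).
have BL x : B n x @[n --> \oo] --> L x by exact: B_cauchy.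
have linL : linear L.
  move=> c x y; apply: (cvg_lim (@norm_hausdorff _ _)).
  have -> : (fun n => B n (c *: x + y)) = (fun n => c *: B n x + B n y).
    by apply/funext => n; rewrite (positive_linear (posB n)).
  by apply: cvgD => //; apply: cvgZr.
have symL : symmetric_operator L.
  move=> x y; apply: (@cvg_unique _ (@norm_hausdorff _ _) ('[B n x, y] @[n --> \oo])).
    exact: cvg_dotl.
  have -> : (fun n => '[B n x, y]) = (fun n => '[x, B n y]).
    by apply/funext => n; rewrite (positive_sym (posB n)).
  exact: cvg_dotr.
have aL x : a x n @[n --> \oo] --> sre '[L x, x].
  by apply: cvg_sre; apply: cvg_dotl.
have aLE x : sre '[L x, x] = limn (a x) by rewrite (cvg_lim _ (aL x)).
have LB n x : '[L x, x] <= '[B n x, x].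
  rewrite -subr_ge0 sre_real_ge0; last by rewrite rpredB ?form_real//; apply: positive_sym.
  by rewrite raddfB /= subr_ge0 aLE; exact: nonincreasing_cvgn_ge.
have L0 x : 0 <= '[L x, x].
  rewrite sre_real_ge0 ?form_real// aLE.
  apply: limr_ge => //; apply: nearW => n; exact/sre_ge0/positive_ge0.
exists L; split=> //.
exact: (positive_form_le (posB 0%N)).
Qed.
End MonotoneLimit.
End StrongLimits.

(** * Uniqueness of the positive square root *)

(** The optimal constant [c >= 0] in [t <= c n] must be 0 under the last
    hypothesis: if it is [m > 0], nearly extremal points [x], those with
    [t x > (m - d) * n x], make the right-hand side of the hypothesis at most
    [K * d * n x ^+ 2] while the left-hand side is at least
    [(m * (m / 2) * n x) ^+ 2]. *)
Lemma extremal_bound_le0 (R : realType) (X : Type) (t n : X -> R) (M K : R) :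
    0 <= M -> 0 <= K -> (forall x, 0 <= n x) -> (forall x, t x <= M * n x) ->
    (forall c, 0 <= c -> c <= M -> (forall x, t x <= c * n x) ->
       forall x, 0 <= t x ->
         (c * t x) ^+ 2 <= K * n x * (c * n x - t x)) ->
  forall x, t x <= 0.
Proof.
move=> M0 K0 n0 tM step x0.
pose E : set R := [set c | [/\ 0 <= c, c <= M & forall x, t x <= c * n x]].
have E0 : E !=set0 by exists M.
have Elb : lbound E 0 by move=> c [].
have hE : has_inf E by split=> //; exists 0.
set m := inf E.
have m0 : 0 <= m by apply: lb_le_inf.
have mM : m <= M by apply: ge_inf => //; exists 0.
have tm x : t x <= m * n x.
  have [nx|nx] := eqVneq (n x) 0; first by rewrite (le_trans (tM x))// nx !mulr0.
  have nx0 : 0 < n x by rewrite lt_def nx n0.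
  rewrite -ler_pdivrMr//; apply: lb_le_inf => // c [_ _ tc].
  by rewrite ler_pdivrMr.
have [mz|mnz] := eqVneq m 0; first by rewrite (le_trans (tm x0))// mz mul0r.
have mp : 0 < m by rewrite lt_def mnz.
pose q := (m * (m / 2)) ^+ 2.
have q0 : 0 < q by rewrite exprn_gt0// !mulr_gt0.
pose d := Num.min (m / 2) (q / (2 * (K + 1))).
have K1 : 0 < K + 1 by rewrite ltr_wpDl.
have d0 : 0 < d by rewrite lt_min !divr_gt0//= mulr_gt0.
have dm : d <= m / 2 by rewrite ge_min lexx.
have Kd : K * d < q.
  apply: (@le_lt_trans _ _ ((K + 1) * (q / (2 * (K + 1))))).
    by apply: ler_pM => //; rewrite ?(ltW d0)// ?lerDl// ge_min lexx orbT.
  have -> : (K + 1) * (q / (2 * (K + 1))) = q / 2.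
    by field; rewrite gt_eqF.
  by lra.
have [x tx] : exists x, (m - d) * n x < t x.
  apply: contrapT => /forallNP h.
  have : E (m - d).
    split; first by rewrite subr_ge0 (le_trans dm)// ler_pdivrMr// ler_pMr// ler1n.
      by rewrite (le_trans _ mM)// gerBl ltW.
    by move=> x; rewrite leNgt; apply/negP/h.
  by move/(ge_inf (ex_intro _ 0 Elb)); rewrite -/m leNgt ltrBlDr ltrDl d0.
have md : m / 2 <= m - d by lra.
have nx0 : 0 < n x.
  rewrite lt_def n0 andbT; apply/eqP => nx.
  by move: tx (tM x); rewrite nx !mulr0 ltNge => /negP.
have tx0 : m / 2 * n x <= t x.
  by apply: ltW; apply: le_lt_trans tx; rewrite ler_wpM2r.
have tp : 0 <= t x by rewrite (le_trans _ tx0)// mulr_ge0// divr_ge0.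
have := step m m0 mM tm x tp.
have lhs : q * n x ^+ 2 <= (m * t x) ^+ 2.
  rewrite -exprMn -mulrA ler_pXn2r ?nnegrE ?mulr_ge0// ?divr_ge0//.
  by rewrite ler_wpM2l.
move=> /(le_trans lhs); apply: contraTT => _; rewrite -ltNge.
apply: (@le_lt_trans _ _ (K * d * n x ^+ 2)); last by rewrite ltr_pM2r// exprn_gt0.
rewrite expr2 [leRHS](_ : _ = K * n x * (d * n x)); last by ring.
by rewrite ler_wpM2l ?mulr_ge0//; lra.
Qed.

Section SquareRoots.
Context {R : realType} {k : scalar_kind} {H : hilbertSpace R k}.
Local Notation K := (base_field R k).
Implicit Types (x y z : H) (A B X Y : H -> H).

Lemma sre_norm_sqr_le (z : K) : sre z ^+ 2 <= sre (`|z| ^+ 2).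
Proof.
rewrite expr2 sreMl ?ger0_real// -expr2 -real_normK ?num_real//.
by rewrite ler_pXn2r ?nnegrE ?sre_ge0// norm_sre_le.
Qed.

(** The square root is operator monotone: [A^2 <= B^2] implies [A <= B].  With
    [T = A - B], [S = A + B] the real part of ['[S x, T x]] is
    [|A x|^2 - |B x|^2 <= 0].  If [c] bounds the form of [T], then [C = c - T]
    is positive, and [c '[T x, x] <= c '[S x, x] <= Re '[S x, C x]], where
    [|C x|^2] is controlled by ['[C x, x] = c |x|^2 - '[T x, x]].  Thus [T] has
    approximate eigenvectors at its upper bound on which [S] is forced to be
    small, and [extremal_bound_le0] concludes. *)
Lemma square_monotone A B : positive_operator A -> positive_operator B ->
  (forall x, `|A x| <= `|B x|) -> forall x, '[A x, x] <= '[B x, x].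
Proof.
move=> posA posB AB x0.
have [MA MA0 bA] := bounded_operator_ge0 (positive_bounded posA).
have [MB MB0 bB] := bounded_operator_ge0 (positive_bounded posB).
have [M M0 AM] := positive_form_bound posA.
have [N N0 BN] := positive_form_bound posB.
have linA := positive_linear posA; have linB := positive_linear posB.
pose t x := sre '[A x, x] - sre '[B x, x].
pose n x := sre (`|x| ^+ 2).
have rA x : '[A x, x] \is Num.real by rewrite ger0_real// positive_ge0.
have rB x : '[B x, x] \is Num.real by rewrite ger0_real// positive_ge0.
suff /(_ x0) : forall x, t x <= 0.
  rewrite /t -raddfB => h; rewrite -subr_ge0 sre_real_ge0 ?rpredB//.
  by move: h; rewrite !raddfB /= subr_le0 subr_ge0.
have nE x : n x = sre (`|x| ^+ 2) by [].
apply: (@extremal_bound_le0 _ _ t n (sre M) (sre ((MA + MB) ^+ 2 * (M + N)))).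
- exact: sre_ge0.
- by apply: sre_ge0; rewrite mulr_ge0 ?exprn_ge0 ?addr_ge0.
- by move=> x; apply: sre_ge0; rewrite exprn_ge0.
- move=> x; rewrite /t nE -sreMl ?ger0_real//.
  apply: le_trans (ler_sre (AM x)); rewrite gerBl sre_ge0//.
  exact: positive_ge0.
move=> c c0 cM tc x tx.
pose C y := scast c *: y - (A y - B y).
have CE y : '[C y, y] = scast c * '[y, y] - ('[A y, y] - '[B y, y]).
  by rewrite /C !dotBl dotZl.
have linC : linear C.
  apply: (linear_subop (A := fun y => scast c *: y)) (linear_subop linA linB).
  by move=> a u v; rewrite scalerDr !scalerA mulrC.
have symC : symmetric_operator C.
  move=> u v; rewrite /C !(dotBl, dotBr) dotZl dotZr sconj_real ?scast_real//.
  by rewrite (positive_sym posA) (positive_sym posB).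
have sreC y : sre '[C y, y] = c * n y - t y.
  by rewrite CE raddfB /= sreMl ?scast_real// scastK -inner_normE raddfB.
have posC y : 0 <= '[C y, y].
  by rewrite sre_real_ge0 ?form_real// sreC subr_ge0.
have bC y : '[C y, y] <= (M + N) * `|y| ^+ 2.
  rewrite CE opprB mulrDl lerD//.
    rewrite -inner_normE ler_wpM2r ?exprn_ge0//.
    by rewrite -(sreK (ger0_real M0)) ler_scast.
  by apply: le_trans (BN y); rewrite gerBl positive_ge0.
have CM := form_bound_norm linC symC posC bC.
have main : c * t x <= sre '[A x + B x, C x].
  have -> : '[A x + B x, C x] =
      scast c * '[A x + B x, x] - '[A x + B x, A x - B x].
    by rewrite /C [LHS]dotBr dotZr sconj_real ?scast_real.
  have -> : sre (scast c * '[A x + B x, x] - '[A x + B x, A x - B x]) =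
      c * (sre '[A x, x] + sre '[B x, x])
      - (sre (`|A x| ^+ 2) - sre (`|B x| ^+ 2)).
    rewrite raddfB /= sreMl ?scast_real// scastK dotDl raddfD /=; congr (_ - _).
    rewrite dotBr !dotDl !raddfB /= !raddfD /= -!inner_normE.
    by rewrite [sre '[B x, A x]]sre_dotC; ring.
  have h1 : sre (`|A x| ^+ 2) <= sre (`|B x| ^+ 2).
    by apply: ler_sre; rewrite ler_pXn2r ?nnegrE.
  have h2 : 0 <= sre '[B x, x] by rewrite sre_ge0 ?positive_ge0.
  rewrite /t; have h3 := mulr_ge0 c0 h2; lra.
have ctx : 0 <= c * t x by rewrite mulr_ge0.
apply: (@le_trans _ _ (sre '[A x + B x, C x] ^+ 2)).
  by rewrite ler_pXn2r ?nnegrE// (le_trans ctx).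
apply: le_trans (sre_norm_sqr_le _) _.
rewrite -sreC nE -sreMl ?ger0_real ?mulr_ge0 ?exprn_ge0 ?addr_ge0//.
rewrite -sreMl ?ger0_real ?mulr_ge0 ?exprn_ge0 ?addr_ge0//.
apply: ler_sre.
apply: (@le_trans _ _ (`|A x + B x| ^+ 2 * `|C x| ^+ 2)).
  by rewrite -exprMn ler_pXn2r ?nnegrE ?mulr_ge0// cauchy_schwarz.
rewrite [leRHS](_ : _ =
    ((MA + MB) * `|x|) ^+ 2 * ((M + N) * '[C x, x])); last first.
  by rewrite exprMn [RHS]mulrACA !mulrA.
apply: ler_pM => //; rewrite ?exprn_ge0//.
rewrite ler_pXn2r ?nnegrE ?mulr_ge0 ?addr_ge0//.
by apply: le_trans (ler_normD _ _) _; rewrite mulrDl lerD.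
Qed.

Lemma positive_square_inj A B : positive_operator A -> positive_operator B ->
  A \o A = B \o B -> A = B.
Proof.
move=> posA posB AB.
have nAB x : `|A x| = `|B x|.
  apply/eqP; rewrite -(eqrXn2 (n := 2))//; apply/eqP; rewrite !inner_normE.
  rewrite (positive_sym posA) (positive_sym posB).
  by move: (congr1 (fun f => f x) AB) => /= ->.
apply: positive_form_eq => // x; apply/eqP.
by rewrite eq_le !square_monotone// => y; rewrite nAB.
Qed.

Lemma adjoint_operatorE A : bounded_operator A -> symmetric_operator A ->
  adjoint_operator A = A.
Proof.
move=> bA symA; apply: xget_unique; first by split.
move=> B [_ AB]; apply/funext => y; apply: dot_ext => x.
by rewrite -AB symA.
Qed.

Lemma abs_operatorE A : positive_operator A -> abs_operator A = A.
Proof.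
move=> posA; rewrite /abs_operator adjoint_operatorE;
  [|exact: positive_bounded|exact: positive_sym].
apply: xget_unique; first by split.
by move=> B [posB BA]; exact: positive_square_inj.
Qed.
End SquareRoots.

(** * Elimination along an orthonormal family, and traces *)

Lemma cvg_sum_nat (K : numFieldType) (V : normedModType K)
    (u : nat -> nat -> V) (l : nat -> V) m :
  (forall i, u i n @[n --> \oo] --> l i) ->
  \sum_(0 <= i < m) u i n @[n --> \oo] --> \sum_(0 <= i < m) l i.
Proof.
move=> ul; elim: m => [|m IH].
  rewrite big_geq//; under eq_fun do rewrite big_geq//; exact: cvg_cst.
by rewrite big_nat_recr//=; under eq_fun do rewrite big_nat_recr//=; exact: cvgD.
Qed.

Section OrthonormalFamilies.
Context {R : realType} {k : scalar_kind} {H : hilbertSpace R k}.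
Local Notation K := (base_field R k).
Implicit Types (x y z : H) (A B X Y : H -> H) (I : set nat) (e : nat -> H).

(** Replacing the values of [e] outside [I] by 0 makes elimination along a
    finite or infinite basis a single sequence indexed by [nat], because eliminating
    the vector 0 does nothing. *)
Definition zero_ext I e i : H := if i \in I then e i else 0.

Lemma zero_ext_in I e i : I i -> zero_ext I e i = e i.
Proof. by move=> Ii; rewrite /zero_ext mem_set. Qed.

Lemma kernel_submod A : linear A -> linear_subspace [set x | A x = 0].
Proof.
move=> linA; split; first by rewrite inE /= (lin0 linA).
by move=> a x y; rewrite !inE /= linA => -> ->; rewrite scaler0 addr0.
Qed.

Lemma span_kernel A (G : set H) x : linear A -> (forall y, G y -> A y = 0) ->
  linear_span G x -> A x = 0.
Proof.
move=> linA GA Gx; apply: (Gx [set x | A x = 0]); split => //.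
exact: kernel_submod.
Qed.

Lemma closed_span_kernel A (G : set H) x : positive_operator A ->
  (forall y, G y -> A y = 0) -> closure (linear_span G) x -> A x = 0.
Proof.
move=> posA GA Gx; have [M M0 AM] := bounded_operator_ge0 (positive_bounded posA).
apply/normr0_eq0/eqP; rewrite eq_le normr_ge0 andbT.
apply/ler_addgt0Pl => eps eps0; rewrite addr0.
have M1 : 0 < M + 1 by rewrite ltr_wpDl.
have [y [Gy]] := Gx _ (nbhsx_ballx x _ (divr_gt0 eps0 M1)).
rewrite -ball_normE /= ltr_pdivlMr// => xy.
have -> : A x = A (x - y).
  have linA := positive_linear posA.
  by rewrite (linB linA) (span_kernel linA GA Gy) subr0.
apply: le_trans (AM _) _; apply: le_trans (ltW xy).
by rewrite mulrC ler_wpM2l// lerDl.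
Qed.

(** The limit kills every [e j] since its form lies below that of the [j.+1]-st
    elimination step, which already vanishes at [e j]. *)
Lemma schur_elim_limit A e : positive_operator A -> exists L,
  [/\ positive_operator L, forall x, schur_elim A e n x @[n --> \oo] --> L x,
      forall n x, '[L x, x] <= '[schur_elim A e n x, x] &
      forall j, L (e j) = 0].
Proof.
move=> posA; have [||L [posL AL LA]] := @monotone_strong_limit _ _ H (schur_elim A e).
- by move=> n; exact: schur_elim_positive.
- by move=> m n x; exact: schur_elim_form_le.
exists L; split=> // j; apply: positive_kernel => //.
apply/eqP; rewrite eq_le positive_ge0// andbT.
by apply: le_trans (LA j.+1 _) _; rewrite schur_elim_kills// dot0l.
Qed.

Lemma positive_id : positive_operator (idfun : H -> H).
Proof.
split=> //; last by move=> x; exact: dot_ge0.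
by split=> //; exists 1 => x; rewrite mul1r.
Qed.

Section Orthonormal.
Context (I : set nat) (e : nat -> H)
  (orth : forall i j, I i -> I j -> '[e i, e j] = (i == j)%:R).
Local Notation c := (zero_ext I e).

Lemma dot_zero_ext_neq i j : i != j -> '[c i, c j] = 0.
Proof.
move=> ij; rewrite /zero_ext; case: ifPn => [/set_mem Ii|_]; last by rewrite dot0l.
case: ifPn => [/set_mem Ij|_]; last by rewrite dot0r.
by rewrite orth// (negPf ij).
Qed.

(** Eliminating an orthonormal family from the identity removes the orthogonal
    projection onto its span.  Bessel's inequality is then positivity of the
    eliminated operator, and Parseval's identity holds because the limit kills
    the whole space. *)
Lemma schur_elim_id n x :
  schur_elim idfun c n x = x - \sum_(0 <= j < n) '[x, c j] *: c j.
Proof.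
elim: n x => [|n IH] x; first by rewrite big_geq// subr0.
have En : schur_elim idfun c n (c n) = c n.
  rewrite IH big_nat big1 ?subr0// => j /andP[_ jn].
  by rewrite dot_zero_ext_neq ?scale0r// gtn_eqF.
rewrite big_nat_recr//= /schur_step En.
rewrite (positive_sym (schur_elim_positive positive_id _ _)) En IH opprD addrA.
congr (_ - _); rewrite /zero_ext; case: ifPn => [/set_mem In|_]; last by rewrite !scaler0.
by rewrite orth// eqxx divr1.
Qed.

Lemma schur_elim_id_form n x : '[schur_elim idfun c n x, x] =
  `|x| ^+ 2 - \sum_(0 <= j < n) `|'[x, c j]| ^+ 2.
Proof.
rewrite schur_elim_id dotBl dot_suml inner_normE; congr (_ - _).
by apply: eq_bigr => j _; rewrite dotZl [X in _ * X]dotC mul_sconj.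
Qed.

Lemma bessel n x : \sum_(0 <= j < n) `|'[x, c j]| ^+ 2 <= `|x| ^+ 2.
Proof.
rewrite -subr_ge0 -schur_elim_id_form positive_ge0//.
exact: schur_elim_positive positive_id _ _.
Qed.
End Orthonormal.

Lemma parseval I e x : orthonormal_basis [set: H] I e ->
  \sum_(0 <= j < n) `|'[x, zero_ext I e j]| ^+ 2 @[n --> \oo] --> (`|x| ^+ 2 : K).
Proof.
case=> _ orth dense_e.
have [L [posL EL _ Le]] := schur_elim_limit (zero_ext I e) positive_id.
have L0 : L x = 0.
  apply: (closed_span_kernel (G := e @` I) posL); last by rewrite dense_e.
  by move=> _ [i Ii <-]; rewrite -(zero_ext_in _ Ii).
have := cvg_dotl (y := x) (EL x); rewrite L0 dot0l => h.
have : `|x| ^+ 2 - '[schur_elim idfun (zero_ext I e) n x, x]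
    @[n --> \oo] --> (`|x| ^+ 2 - 0 : K).
  by apply: cvgB => //; exact: cvg_cst.
rewrite subr0; apply: cvg_trans; apply: near_eq_cvg; apply: nearW => n /=.
by rewrite schur_elim_id_form// subKr.
Qed.

(** Replaces the independence of the trace from the basis: the trace of [A] over
    a family [x] satisfying Bessel's inequality is at most its trace over an
    orthonormal basis [g].  Elimination along [g] writes the form of [A] as a sum
    of squares [|'[u j, _]|^2 / c j] and a remainder tending to 0.  Summing over
    the [x i], Bessel bounds each square by [|u j|^2 / c j]; summing over the
    [g l] instead, Parseval shows that the same numbers [|u j|^2 / c j] add up to
    at most the trace over [g]. *)
Lemma trace_bessel_le A I g (C : R) m (x : nat -> H) :
  positive_operator A -> orthonormal_basis [set: H] I g ->
  (forall n, \sum_(0 <= j < n) sre '[A (zero_ext I g j), zero_ext I g j] <= C) ->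
  (forall v, \sum_(0 <= i < m) `|'[v, x i]| ^+ 2 <= `|v| ^+ 2) ->
  \sum_(0 <= i < m) sre '[A (x i), x i] <= C.
Proof.
move=> posA gB AC xB.
have [L [posL AL _ Lg]] := schur_elim_limit (zero_ext I g) posA.
have L0 v : L v = 0.
  case: gB => _ _ dg; apply: (closed_span_kernel (G := g @` I) posL).
    by move=> _ [i Ii <-]; rewrite -(zero_ext_in _ Ii).
  by rewrite dg.
pose u j := schur_elim A (zero_ext I g) j (zero_ext I g j).
pose c j := '[u j, zero_ext I g j].
have c0 j : 0 <= (c j)^-1.
  by rewrite invr_ge0 positive_ge0//; exact: schur_elim_positive.
have AE n y : '[A y, y] = '[schur_elim A (zero_ext I g) n y, y] +
    \sum_(0 <= j < n) `|'[u j, y]| ^+ 2 / c j by exact: schur_elim_form.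
pose W n : K := \sum_(0 <= j < n) `|u j| ^+ 2 / c j.
have WC n : sre (W n) <= C.
  have cvgW : sre (\sum_(0 <= j < n)
        (\sum_(0 <= l < p) `|'[u j, zero_ext I g l]| ^+ 2) / c j)
      @[p --> \oo] --> sre (W n).
    apply: cvg_sre; apply: (@cvg_sum_nat _ K^o) => j.
    by apply: cvgMl; exact: parseval.
  rewrite -(cvg_lim (@Rhausdorff R) cvgW); apply: limr_le.
    by apply/cvg_ex; exists (sre (W n)).
  apply: nearW => p; apply: le_trans (AC p).
  rewrite -raddf_sum; apply: ler_sre.
  rewrite [leLHS](_ : _ = \sum_(0 <= l < p) \sum_(0 <= j < n)
      `|'[u j, zero_ext I g l]| ^+ 2 / c j).
    apply: ler_sum => l _; rewrite (AE n) lerDr positive_ge0//.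
    exact: schur_elim_positive.
  by rewrite exchange_big /=; apply: eq_bigr => j _; rewrite mulr_suml.
have bnd n : \sum_(0 <= i < m) sre '[A (x i), x i] <=
    sre (\sum_(0 <= i < m) '[schur_elim A (zero_ext I g) n (x i), x i]) + C.
  rewrite -raddf_sum; apply: le_trans (lerD (lexx _) (WC n)).
  rewrite -raddfD; apply: ler_sre.
  under eq_bigr do rewrite (AE n).
  rewrite big_split/= lerD2l exchange_big/=; apply: ler_sum => j _.
  by rewrite -mulr_suml ler_wpM2r.
have cvgA : sre (\sum_(0 <= i < m) '[schur_elim A (zero_ext I g) n (x i), x i]) + C
    @[n --> \oo] --> C.
  rewrite -[X in _ --> X]add0r; apply: cvgD; last exact: cvg_cst.
  rewrite -[X in _ --> X](raddf0 (@sre R k)); apply: cvg_sre.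
  rewrite -[X in _ --> X](_ : \sum_(0 <= i < m) (0 : K) = _); last by rewrite big1.
  apply: (@cvg_sum_nat _ K^o) => i.
  by have := cvg_dotl (y := x i) (AL (x i)); rewrite L0 dot0l.
rewrite -(cvg_lim (@Rhausdorff R) cvgA); apply: limr_ge.
  by apply/cvg_ex; exists C.
exact: nearW.
Qed.
End OrthonormalFamilies.

(** * Shorts computed by elimination *)

Section Shorts.
Context {R : realType} {k : scalar_kind} {H : hilbertSpace R k}.
Local Notation K := (base_field R k).
Implicit Types (x y z : H) (A B X Y : H -> H) (S : set H).

Lemma dot_eq0C x y : '[x, y] = 0 -> '[y, x] = 0.
Proof. by move=> xy; apply/eqP; rewrite -normr_eq0 norm_dotC xy normr0. Qed.

Lemma subspace0 S : linear_subspace S -> S 0.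
Proof. by case; rewrite inE. Qed.

Lemma subspace_lin S a x y : linear_subspace S -> S x -> S y -> S (a *: x + y).
Proof. by case=> _ lS Sx Sy; have := lS a x y; rewrite !inE; apply. Qed.

Lemma subspaceD S x y : linear_subspace S -> S x -> S y -> S (x + y).
Proof. by move=> lS Sx; rewrite -[x]scale1r; exact: subspace_lin. Qed.

Lemma subspaceZ S a x : linear_subspace S -> S x -> S (a *: x).
Proof.
by move=> lS Sx; rewrite -[a *: x]addr0; apply: subspace_lin => //; exact: subspace0.
Qed.

Lemma subspaceB S x y : linear_subspace S -> S x -> S y -> S (x - y).
Proof.
by move=> lS Sx Sy; rewrite -scaleN1r; apply: subspaceD => //; exact: subspaceZ.
Qed.

Lemma subspace_sum S n (F : nat -> H) : linear_subspace S ->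
  (forall j, (j < n)%N -> S (F j)) -> S (\sum_(0 <= j < n) F j).
Proof.
move=> lS SF; rewrite big_nat; apply: (big_ind S); first exact: subspace0.
  by move=> x y; exact: subspaceD.
by move=> j /andP[_ /SF].
Qed.

Lemma span_subspace (G : set H) : linear_subspace (linear_span G).
Proof.
split; first by rewrite inE => S [lS _]; exact: subspace0.
move=> a x y; rewrite !inE => Gx Gy S [lS GS].
by apply: subspace_lin => //; [apply: Gx|apply: Gy].
Qed.

Lemma orthoproj_unique S x y : linear_subspace S -> S y ->
  (forall z, S z -> '[x - y, z] = 0) -> orthoproj S x = y.
Proof.
move=> lS Sy xy; apply: xget_unique => // y' [Sy' xy'].
apply/subr0_eq/dot_eq0; have Sd : S (y' - y) by exact: subspaceB.
have {1}-> : y' - y = (x - y) - (x - y') by rewrite opprB [RHS]addrC addrA subrK.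
by rewrite dotBl xy// xy'// subrr.
Qed.

Lemma positive_add A B : positive_operator A -> positive_operator B ->
  positive_operator (A \+ B).
Proof.
move=> posA posB.
have [M M0 AM] := positive_form_bound posA.
have [N N0 BN] := positive_form_bound posB.
apply: (@positive_of_form_bound _ _ _ _ (M + N)); rewrite ?addr_ge0//.
- move=> a x y /=; rewrite (positive_linear posA) (positive_linear posB).
  by rewrite scalerDr addrACA.
- by move=> x y; rewrite /= dotDl dotDr (positive_sym posA) (positive_sym posB).
- by move=> x; rewrite /= dotDl addr_ge0// positive_ge0.
- by move=> x; rewrite /= dotDl mulrDl lerD.
Qed.

Lemma positive_conj A T : positive_operator A -> positive_operator T ->
  positive_operator (T \o A \o T).
Proof.
move=> posA posT.
have [M M0 AM] := positive_form_bound posA.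
have [N N0 TN] := bounded_operator_ge0 (positive_bounded posT).
have TA x : '[T (A (T x)), x] = '[A (T x), T x] by rewrite (positive_sym posT).
apply: (@positive_of_form_bound _ _ _ _ (M * N ^+ 2)).
- move=> a x y /=; rewrite (positive_linear posT) (positive_linear posA).
  by rewrite (positive_linear posT).
- by move=> x y /=; rewrite (positive_sym posT) (positive_sym posA) (positive_sym posT).
- by rewrite mulr_ge0// exprn_ge0.
- by move=> x /=; rewrite TA positive_ge0.
- move=> x /=; rewrite TA; apply: le_trans (AM _) _; rewrite -mulrA ler_wpM2l//.
  by rewrite -exprMn ler_pXn2r ?nnegrE ?mulr_ge0.
Qed.

Lemma linear_kills A n (t : nat -> K) (u : nat -> H) : linear A ->
  (forall j, (j < n)%N -> A (u j) = 0) -> A (\sum_(0 <= j < n) t j *: u j) = 0.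
Proof.
move=> linA Au; rewrite (lin_sum linA) big_nat big1// => j /andP[_ jn].
by rewrite (linZ linA) Au// scaler0.
Qed.

Lemma shortE S A X : short_candidates S A X ->
  (forall Y, short_candidates S A Y -> ople Y X) -> short S A = X.
Proof.
move=> SX maxX; apply: xget_unique => // Y [SY maxY].
by apply: ople_anti; [case: SY|case: SX|exact: maxX|exact: maxY].
Qed.

(** Minimality of the eliminated form: since [X] does not see the vectors [e j],
    its form at [x] can be evaluated at [x - y], where the form of [A] takes the
    value ['[schur_elim A e n x, x]]. *)
Lemma form_le_elim A X (e : nat -> H) n x : positive_operator A ->
    positive_operator X -> (forall j, X (e j) = 0) ->
    (forall t : nat -> K, let y := x - \sum_(0 <= j < n) t j *: e j in
       '[X y, y] <= '[A y, y]) ->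
  '[X x, x] <= '[schur_elim A e n x, x].
Proof.
move=> posA posX Xe XA; have [t At] := schur_elim_shift posA e n x.
have := XA t; set y := \sum_(_ <= _ < _) _ => /= {XA} XA.
have posn := schur_elim_positive posA e n.
have killy B : positive_operator B -> (forall j, (j < n)%N -> B (e j) = 0) ->
    '[B (x - y), x - y] = '[B x, x].
  move=> posB Be; have lB := positive_linear posB.
  have By : B y = 0 by exact: linear_kills.
  by rewrite (linB lB) By subr0 dotBr (positive_sym posB x y) By dot0r subr0.
rewrite -(killy X)//; apply: le_trans XA _.
rewrite -[leRHS](killy _ posn); last by move=> j jn; exact: schur_elim_kills.
rewrite (linB (positive_linear posn)) (linear_kills _ (positive_linear posn)).
  by rewrite subr0 At.
by move=> j jn; exact: schur_elim_kills.
Qed.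

Lemma form_le_limit X L (B : nat -> H -> H) x : positive_operator X ->
    positive_operator L -> (forall n, '[X x, x] <= '[B n x, x]) ->
    B n x @[n --> \oo] --> L x ->
  '[X x, x] <= '[L x, x].
Proof.
move=> posX posL XB BL.
rewrite -subr_ge0 sre_real_ge0; last by rewrite rpredB ?ger0_real ?positive_ge0.
rewrite raddfB /= subr_ge0.
have BLx : sre '[B n x, x] @[n --> \oo] --> sre '[L x, x].
  by apply: cvg_sre; exact: cvg_dotl.
apply: (cvgr_to_ge BLx); apply: nearW => n; exact: ler_sre.
Qed.

Section Split.
Context (H1 H2 : set H) (split12 : orthogonal_direct_sum H1 H2).
Local Notation P1 := (orthoproj H1).

Let lin1 : linear_subspace H1. Proof. by case: split12 => -[]. Qed.
Let lin2 : linear_subspace H2. Proof. by case: split12 => _ []. Qed.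
Let ortho x y : H1 x -> H2 y -> '[x, y] = 0.
Proof. by case: split12 => _ _ o _; exact: o. Qed.

Lemma split_ortho_mem z : (forall y, H2 y -> '[z, y] = 0) -> H1 z.
Proof.
case: split12 => _ _ _ /(_ z)[x [y [Hx Hy ->]]] /(_ y Hy).
by rewrite dotDl ortho// add0r => /dot_eq0 ->; rewrite addr0.
Qed.

Lemma split_projE x y : H1 x -> H2 y -> P1 (x + y) = x.
Proof.
move=> Hx Hy; apply: orthoproj_unique => // z Hz.
by rewrite addrAC subrr add0r; apply: dot_eq0C; exact: ortho.
Qed.

Lemma split_proj_mem x : H1 (P1 x).
Proof.
by case: split12 => _ _ _ /(_ x)[u [v [Hu Hv ->]]]; rewrite split_projE.
Qed.

Lemma split_proj_res x : H2 (x - P1 x).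
Proof.
case: split12 => _ _ _ /(_ x)[u [v [Hu Hv ->]]]; rewrite split_projE//.
by rewrite addrAC subrr add0r.
Qed.

Lemma split_proj_dot x y : '[P1 x, y] = '[P1 x, P1 y].
Proof.
rewrite -{1}(subrK (P1 y) y) dotDr ortho ?add0r//; first exact: split_proj_mem.
exact: split_proj_res.
Qed.

Lemma split_proj_norm_le x : `|P1 x| ^+ 2 <= `|x| ^+ 2.
Proof.
rewrite !inner_normE; have := split_proj_mem x; have := split_proj_res x.
move: (P1 x) (subrK (P1 x) x) => p; move: (x - p) => r <- Hr Hp.
rewrite !dotDl !dotDr (ortho Hp Hr) (dot_eq0C (ortho Hp Hr)) addr0 add0r.
by rewrite lerDr dot_ge0.
Qed.

Lemma split_proj_positive : positive_operator P1.
Proof.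
apply: (positive_form_le positive_id).
- move=> a x y; rewrite -{1}(subrK (P1 x) x) -{1}(subrK (P1 y) y).
  rewrite [x - _ + _]addrC [y - _ + _]addrC scalerDr addrACA split_projE//.
    by apply: subspace_lin => //; exact: split_proj_mem.
  by apply: subspace_lin => //; exact: split_proj_res.
- by move=> x y; rewrite split_proj_dot dotC -split_proj_dot -dotC.
- by move=> x; rewrite split_proj_dot dot_ge0.
- by move=> x; rewrite split_proj_dot /= -!inner_normE; exact: split_proj_norm_le.
Qed.

Lemma symmetric_kills X y : symmetric_operator X -> range X `<=` H1 -> H2 y ->
  X y = 0.
Proof.
move=> symX XH1 Hy; apply: dot_eq0; rewrite symX; apply: dot_eq0C.
by apply: ortho => //; apply: XH1; exists (X y).
Qed.

Context (I : set nat) (e : nat -> H) (He : orthonormal_basis H2 I e).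
Local Notation c := (zero_ext I e).

Let orth i j : I i -> I j -> '[e i, e j] = (i == j)%:R.
Proof. by case: He => _ o _; exact: o. Qed.

Lemma zero_ext_mem j : H2 (c j).
Proof.
rewrite /zero_ext; case: ifPn => [/set_mem Ij|_]; last exact: subspace0.
case: He => _ _ <-; apply: subset_closure => S [_]; apply; by exists j.
Qed.

Lemma basis_kills L y : positive_operator L -> (forall j, L (c j) = 0) ->
  H2 y -> L y = 0.
Proof.
move=> posL Lc; case: He => _ _ <-; apply: closed_span_kernel => //.
by move=> _ [j Ij <-]; rewrite -(zero_ext_in _ Ij).
Qed.

(** The short is the strong limit of the elimination along a basis of [H2]: the
    limit kills [H2], hence by symmetry has its range in [H1], and it dominates
    every competitor because each elimination step does. *)
Lemma short_elim_limit A L : positive_operator A -> positive_operator L ->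
    (forall x, schur_elim A c n x @[n --> \oo] --> L x) ->
    (forall n x, '[L x, x] <= '[schur_elim A c n x, x]) ->
    (forall j, L (c j) = 0) ->
  short H1 A = L.
Proof.
move=> posA posL AL LA Lc; apply: shortE.
  split=> //; first by apply: ople_form => // x; exact: LA 0%N x.
  move=> _ [x _ <-]; apply: split_ortho_mem => y Hy.
  by rewrite (positive_sym posL) (basis_kills posL Lc Hy) dot0r.
move=> X [posX XA XH1]; apply: ople_form => // x.
apply: (form_le_limit (B := schur_elim A c)) => // n.
apply: form_le_elim => //.
  by move=> j; apply: symmetric_kills => //; [exact: positive_sym|exact: zero_ext_mem].
by move=> t; exact: ople_le.
Qed.

Lemma first_span_projE n x :
  orthoproj (first_span I e n) x = \sum_(0 <= j < n) '[x, c j] *: c j.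
Proof.
have En z : first_span I e n z -> schur_elim idfun c n z = 0.
  apply: span_kernel.
    exact: positive_linear (schur_elim_positive (positive_id (H := H)) _ _).
  move=> _ [j [Ij jn] <-]; rewrite -(zero_ext_in _ Ij).
  exact: (schur_elim_kills (positive_id (H := H)) c jn).
have lF : linear_subspace (first_span I e n) by exact: span_subspace.
apply: orthoproj_unique => //.
  apply: (subspace_sum lF) => j jn; apply: (subspaceZ _ lF).
  rewrite /zero_ext; case: ifPn => [/set_mem Ij|_]; last exact: subspace0.
  by move=> S [_]; apply; exists j.
move=> z /En Ez; rewrite -(schur_elim_id orth).
rewrite (positive_sym (schur_elim_positive (positive_id (H := H)) _ _)) Ez.
by rewrite dot0r.
Qed.

Local Notation P := (split_proj H1 I e).

Lemma compress_proj_positive n : positive_operator (P n).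
Proof.
apply: positive_add split_proj_positive _.
have posE := schur_elim_positive (positive_id (H := H)) c n.
have -> : orthoproj (first_span I e n) = idfun \- schur_elim idfun c n.
  apply/funext => x; rewrite first_span_projE /= (schur_elim_id orth).
  by rewrite opprB addrC subrK.
apply: ople_form => //; first exact: positive_id.
by move=> x; exact: (schur_elim_form_le (positive_id (H := H)) c x (leq0n n)).
Qed.

(** Arguments moved from [H1] by elimination stay in the range of the
    projection, where the form of the compression agrees with that of [A]. *)
Lemma compress_proj_id n h (t : nat -> K) : H1 h ->
  let y := h - \sum_(0 <= j < n) t j *: c j in P n y = y.
Proof.
move=> Hh /=; set s := \sum_(_ <= _ < _) _.
have Hs : H2 (- s).
  rewrite -sub0r; apply: subspaceB => //; first exact: subspace0.
  apply: subspace_sum => // j _; apply: (subspaceZ _ lin2); exact: zero_ext_mem.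
rewrite /split_proj /= split_projE// first_span_projE; congr (_ + _).
have posE := schur_elim_positive (positive_id (H := H)) c n.
have := schur_elim_id orth n (h - s); rewrite (linB (positive_linear posE)).
rewrite (linear_kills _ (positive_linear posE)); last first.
  by move=> j jn; exact: (schur_elim_kills (positive_id (H := H)) c jn).
rewrite schur_elim_id// [X in h - X]big1 ?subr0; last first.
  by move=> j _; rewrite ortho ?scale0r//; exact: zero_ext_mem.
move=> E; apply/eqP; rewrite eq_sym -subr_eq0; apply/eqP.
by apply: (addrI h); rewrite addr0 [RHS]E addrA.
Qed.

(** Compressing by [P n] commutes with eliminating the first [n] basis vectors.
    After that, the compression kills the rest of [H2] and the eliminated
    vectors are killed as well, so only [H1] is left and [n] steps compute the short. *)
Lemma short_compression A n : positive_operator A ->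
  short H1 (compression H1 I e A n) = P1 \o schur_elim A c n \o P1.
Proof.
move=> posA; have posn := schur_elim_positive posA c n.
have posP := compress_proj_positive n.
have pos1 := split_proj_positive.
have posC : positive_operator (compression H1 I e A n) by exact: positive_conj.
have posS : positive_operator (P1 \o schur_elim A c n \o P1).
  exact: positive_conj.
have formS x :
    '[P1 (schur_elim A c n (P1 x)), x] = '[schur_elim A c n (P1 x), P1 x].
  by rewrite (positive_sym pos1).
have elimP x : schur_elim A c n (P n x) = schur_elim A c n (P1 x).
  rewrite /split_proj /= (linD (positive_linear posn)) first_span_projE.
  rewrite (linear_kills _ (positive_linear posn)) ?addr0// => j jn.
  exact: schur_elim_kills.
have formC x : '[compression H1 I e A n x, x] = '[A (P n x), P n x].
  by rewrite /= (positive_sym posP).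
apply: shortE.
  split=> //; last by move=> _ [x _ <-]; exact: split_proj_mem.
  apply: ople_form => // x; rewrite [leLHS]formS formC.
  have -> : '[schur_elim A c n (P1 x), P1 x] =
      '[schur_elim A c n (P n x), P n x].
    by rewrite -elimP (positive_sym posn) -elimP -(positive_sym posn).
  exact: (schur_elim_form_le posA c _ (leq0n n)).
move=> X [posX XA XH1]; apply: ople_form => // x; rewrite [leRHS]formS.
have Xkills y : H2 y -> X y = 0 by apply: symmetric_kills => //; exact: positive_sym.
have XE : X x = X (P1 x).
  apply/subr0_eq; rewrite -(linB (positive_linear posX)); apply: Xkills.
  exact: split_proj_res.
rewrite XE (positive_sym posX) XE -(positive_sym posX).
apply: form_le_elim => //; first by move=> j; apply: Xkills; exact: zero_ext_mem.
move=> t /=; set y := _ - _.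
have Py : P n y = y by apply: compress_proj_id; exact: split_proj_mem.
by have := ople_le y XA; rewrite formC Py.
Qed.
End Split.
End Shorts.

(** * Convergence in trace norm *)

Lemma series_dominated_cvg0 (R : realType) (d : nat -> nat -> R)
    (b : nat -> R) (C : R) :
    (forall n i, 0 <= d n i) -> (forall n i, d n i <= b i) ->
    (forall m, \sum_(0 <= i < m) b i <= C) ->
    (forall i, d n i @[n --> \oo] --> (0 : R)) ->
  (\sum_(0 <= i <oo) (d n i)%:E)%E @[n --> \oo] --> 0%E.
Proof.
move=> d0 db bC dcvg.
have b0 i : 0 <= b i by apply: le_trans (db 0%N i).
have seriesE (u : nat -> R) : (forall i, 0 <= u i) -> (forall i, u i <= b i) ->
    cvgn (series u).
  move=> u0 ub; apply: nondecreasing_is_cvgn.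
    by apply/nondecreasing_seqP => n; rewrite /series /= big_nat_recr//= lerDl.
  exists C => _ [m _ <-]; apply: le_trans (bC m).
  by apply: ler_sum.
have cvgb := seriesE b b0 (fun i => lexx _).
have cvgd n := seriesE (d n) (d0 n) (db n).
have -> : (fun n => (\sum_(0 <= i <oo) (d n i)%:E)%E) =
    (fun n => (limn (series (d n)))%:E).
  apply/funext => n; rewrite -EFin_lim//; congr (limn _); apply/funext => m /=.
  by rewrite sumEFin.
apply: cvg_EFin; first exact: nearW.
apply/cvgrPdist_le => eps eps0.
have [N _ bN] : \forall m \near \oo, `|limn (series b) - series b m| < eps / 2.
  by have /cvgrPdist_lt := cvgb; apply; rewrite divr_gt0.
have head : \sum_(0 <= i < N) d n i @[n --> \oo] --> (0 : R).
  rewrite -[X in _ --> X](_ : \sum_(0 <= i < N) (0 : R) = _); last by rewrite big1.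
  exact: (@cvg_sum_nat _ R^o).
(* the first [N] terms are small for large [n], the tail is dominated by [b] *)
have {}head : \forall n \near \oo, \sum_(0 <= i < N) d n i < eps / 2.
  have e2 : 0 < eps / 2 by rewrite divr_gt0.
  move/cvgrPdist_lt: head => /(_ _ e2); apply: filterS => n.
  by rewrite sub0r normrN; apply: le_lt_trans; exact: ler_norm.
move: head; apply: filterS => n hn /=.
have lim_ge0 : 0 <= limn (series (d n)).
  by apply: limr_ge => //; apply: nearW => m; rewrite /series /= sumr_ge0.
rewrite sub0r normrN ger0_norm//; apply: limr_le => //.
apply: nearW => m; rewrite /series /=.
apply: (@le_trans _ _ (\sum_(0 <= i < maxn N m) d n i)).
  rewrite (@big_cat_nat _ _ _ m 0%N (maxn N m))//= ?leq_maxr// lerDl.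
  by rewrite sumr_ge0.
rewrite (@big_cat_nat _ _ _ N 0%N (maxn N m))//= ?leq_maxl//.
rewrite [leRHS](splitr eps) lerD ?(ltW hn)//.
apply: (@le_trans _ _ (\sum_(N <= i < maxn N m) b i)); first by apply: ler_sum.
apply: le_trans (ltW (bN N (leqnn N))).
apply: le_trans (ler_norm _); rewrite lerBrDr addrC.
rewrite /series /= -(@big_cat_nat _ _ _ N 0%N (maxn N m))//= ?leq_maxl//.
apply: (nondecreasing_cvgn_le (u_ := series b)) => //.
by apply/nondecreasing_seqP => p; rewrite /series /= big_nat_recr//= lerDl.
Qed.

Section TraceNorm.
Context {R : realType} {k : scalar_kind} {H : hilbertSpace R k}.
Local Notation K := (base_field R k).
Implicit Types (x y z : H) (A B X Y : H -> H) (S : set H).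

Lemma trace_normE I (e : nat -> H) A : positive_operator A ->
  trace_norm I e A =
  (\sum_(0 <= i <oo) (sre '[A (zero_ext I e i), zero_ext I e i])%:E)%E.
Proof.
move=> posA; rewrite /trace_norm abs_operatorE// eseries_mkcond.
apply: eq_eseriesr => i _; rewrite /zero_ext; case: ifPn => // _.
by rewrite dot0r raddf0.
Qed.

Lemma trace_class_bound A : positive_operator A -> trace_class A ->
  exists I (e : nat -> H) (C : R), orthonormal_basis [set: H] I e /\
    forall n, \sum_(0 <= j < n) sre '[A (zero_ext I e j), zero_ext I e j] <= C.
Proof.
move=> posA [_ [I [e [He]]]]; rewrite trace_normE// => trA.
set u := fun i => (sre '[A (zero_ext I e i), zero_ext I e i])%:E.
have u0 i : (0 <= u i)%E by rewrite lee_fin sre_ge0// positive_ge0.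
have fin : (\sum_(0 <= i <oo) u i)%E \is a fin_num.
  by rewrite ge0_fin_numE//; apply: nneseries_ge0 => i _ _; exact: u0.
exists I, e, (fine (\sum_(0 <= i <oo) u i)%E); split=> // n.
rewrite -lee_fin fineK// -sumEFin.
by apply: (nneseries_lim_ge (u_ := u)) => i _ _; exact: u0.
Qed.
End TraceNorm.

Theorem corollary3p4 (R : realType) (k : scalar_kind) (H : hilbertSpace R k)
    (A : H -> H) (H1 H2 : set H) (I : set nat) (e : nat -> H) :
  separable_space H ->
  positive_operator A ->
  trace_class A ->
  orthogonal_direct_sum H1 H2 ->
  orthonormal_basis H2 I e ->
  forall (J : set nat) (f : nat -> H),
    orthonormal_basis [set: H] J f ->
    trace_norm J f (short H1 (compression H1 I e A n) \- short H1 A)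
      @[n --> \oo] --> 0%E.
Proof.
move=> _ posA trA split12 He J f Hf.
have [L [posL AL LA Lc]] := schur_elim_limit (zero_ext I e) posA.
have [I' [g [C [Hg trC]]]] := trace_class_bound posA trA.
have pos1 := split_proj_positive split12.
rewrite (short_elim_limit split12 He posA posL AL LA Lc).
(* the difference of the two shorts, whose form is that of
   [schur_elim _ _ n - L] seen from H1 *)
pose D n := (orthoproj H1 \o schur_elim A (zero_ext I e) n \o orthoproj H1) \- L.
have LE x : '[L x, x] = '[L (orthoproj H1 x), orthoproj H1 x].
  have Lx : L x = L (orthoproj H1 x).
    apply/subr0_eq; rewrite -(linB (positive_linear posL)).
    by apply: (basis_kills He) => //; exact: split_proj_res.
  by rewrite Lx (positive_sym posL) Lx -(positive_sym posL).
have DE n x : '[D n x, x] =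
    '[schur_elim A (zero_ext I e) n (orthoproj H1 x), orthoproj H1 x] -
    '[L (orthoproj H1 x), orthoproj H1 x].
  by rewrite /D /= dotBl LE (positive_sym pos1).
have posD n : positive_operator (D n).
  apply: ople_form => //.
    by apply: positive_conj => //; exact: schur_elim_positive.
  move=> x; have : 0 <= '[D n x, x] by rewrite DE subr_ge0; exact: LA.
  by rewrite /D /= dotBl subr_ge0.
pose c := zero_ext J f.
have -> : (fun n => trace_norm J f (short H1 (compression H1 I e A n) \- L)) =
    (fun n => (\sum_(0 <= i <oo) (sre '[D n (c i), c i])%:E)%E).
  apply/funext => n; rewrite (short_compression split12 He n posA).
  exact: (trace_normE J f (posD n)).
apply: (@series_dominated_cvg0 _ _
  (fun i => sre '[A (orthoproj H1 (c i)), orthoproj H1 (c i)]) C).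
- by move=> n i; rewrite sre_ge0// positive_ge0.
- move=> n i; apply: ler_sre; rewrite DE.
  apply: (@le_trans _ _
    '[schur_elim A (zero_ext I e) n (orthoproj H1 (c i)), orthoproj H1 (c i)]).
    by rewrite gerBl positive_ge0.
  exact: (schur_elim_form_le posA _ _ (leq0n n)).
- move=> m; apply: (trace_bessel_le posA Hg trC) => v.
  under eq_bigr do rewrite -(positive_sym pos1).
  apply: le_trans (bessel _ _ _) (split_proj_norm_le split12 v).
  by case: Hf.
- move=> i; have -> : (0 : R) = sre (0 : base_field R k) by rewrite raddf0.
  apply: cvg_sre; under eq_fun do rewrite DE.
  have -> : (0 : base_field R k) =
      '[L (orthoproj H1 (c i)), orthoproj H1 (c i)] -
      '[L (orthoproj H1 (c i)), orthoproj H1 (c i)] by rewrite subrr.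
  by apply: cvgB; [apply: cvg_dotl; exact: AL|exact: cvg_cst].
Qed.
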